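(* Let $\mathcal T$ be a finite set of formulas and $\mathcal I_0\subseteq\mathcal I$ a finite set of indices. Let the $\Sigma^{\mathcal I}$-model $(\mathcal M_{\mathcal I},\models_\ll)$ be indefinitely large and adequate for $\mathcal T$. Then there is a finite set $\mathcal J$ with $\mathcal I_0\subseteq\mathcal J\subseteq\mathcal I$ such that $(\mathcal M_{\mathcal J},\models_\ll)$ is a $\mathcal T$-submodel of $(\mathcal M_{\mathcal I},\models_\ll)$ which is adequate for $\mathcal T$.
   Context: $\mathcal I$: non-empty set with directed preorder $\le$; $\uparrow i=\{i'\ge i\}$. Contexts $C=(i_0,\dots,i_{n-1})\in\mathcal I^n$, $()$ empty, $Ci$ extension. $\mathfrak D_n$: $\mathcal H\in\mathfrak D_0$ iff $\mathcal H=\{()\}$; $\mathcal H\in\mathfrak D_1$ iff $\uparrow i\subseteq\mathcal H$ for some $i$; for $\mathcal H\subseteq\mathcal I^{n+1}$, $\mathcal H\in\mathfrak D_{n+1}$ iff $\{C\in\mathcal I^n:\{i:Ci\in\mathcal H\}\in\mathfrak D_1\}\in\mathfrak D_n$. System $\mathcal M_{\mathcal I}=(\mathcal M_i)$: finite sets with $\mathcal M_i\subseteq\mathcal M_{i'}$ for $i\le i'$, at least one non-empty; $\mathcal M_C=\mathcal M_{i_0}\times\dots\times\mathcal M_{i_{n-1}}$. $k$-ary relation: compatible family $(R_C)_{C\in\mathcal H}$, $\emptyset\ne\mathcal H\subseteq\mathcal I^k$, $R_C\subseteq\mathcal M_C$. $\Sigma$: first-order signature with relation symbols only; $\Sigma^{\mathcal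 I}$: assignments $R:C$, $C\in\mathcal I^{\mathrm{arity}(R)}$, at least one per symbol; indefinitely large iff $\{C:R:C\in\Sigma^{\mathcal I}\}\in\mathfrak D_n$ for each $n$-ary $R$. $\Sigma^{\mathcal I}$-structure: system plus per symbol $R$ a relation $R_{\mathcal H}$ with $\mathcal H\supseteq\{C:R:C\in\Sigma^{\mathcal I}\}$. $\ll$-relation: $(\ll_n)_n$, $\ll_n\subseteq\mathcal I^n$, $Ci\in\ll_{n+1}\Rightarrow C\in\ll_n$; elements $\ll$-contexts; $C\ll i$ iff $Ci\in\ll_{n+1}$; indefinitely large iff $\ll_n\in\mathfrak D_n$ for all $n$. Formulas: variables $x_0,x_1,\dots$, $\bot,\to,\land,\lor,\forall,\exists$, no function symbols; $n$-ary formulas have free variables among $x_0,\dots,x_{n-1}$, quantifiers bind $x_n$. Declarations $C\vdash\Phi$ ($C$ a $\ll$-context): $C\vdash\bot$; $C\vdash Rx_{k_0}\dots x_{k_{m-1}}$ iff some $j_l\ge i_{k_l}$ with $R:(j_0,\dots,j_{m-1})\in\Sigma^{\mathcal I}$; connectives: both parts; $C\vdash\forall x\Psi$ iff $C\vdash\exists x\Psi$ iff $Ci\vdash\Psi$ for some $i$ with $C\ll i$. Interpretation $\models_\ll$ (for $C\vdash\Phi$, $\vec a\in\mathcal M_C$): atomic iff $R_{(j_0,\dots)}(a_{k_0},\dots)$ for some declared $(j_0,\dots)$; $\bot$ false; connectives classical; $\forall x\Phi[\vec a:C]$ iff for some $i$ with $C\ll i$, $Ci\vdash\Phi$: $\Phi[\vec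 ab:Ci]$ for all $b\in\mathcal M_i$; $\exists x\Phi[\vec a:C]$ iff for all such $i$ some $b\in\mathcal M_i$ with $\Phi[\vec ab:Ci]$. The model $(\mathcal M_{\mathcal I},\models_\ll)$ is indefinitely large iff $\Sigma^{\mathcal I}$ and $\ll$ are. For directed $\mathcal J\subseteq\mathcal I$: $\mathcal M_{\mathcal J}=(\mathcal M_j)_{j\in\mathcal J}$ with $\Sigma^{\mathcal J}=\{R:C\in\Sigma^{\mathcal I}:C\in\mathcal J^n\}$, same instances, and $\ll$ restricted to $(\ll_n\cap\mathcal J^n)_n$. $(\mathcal M_{\mathcal J},\models_\ll)$ is a $\mathcal T$-submodel of $(\mathcal M_{\mathcal I},\models_\ll)$ iff $\mathcal M_{\mathcal J}\models_\ll\Phi[\vec a:C]\iff\mathcal M_{\mathcal I}\models_\ll\Phi[\vec a:C]$ for all $n$-ary $\Phi\in\mathcal T$, all $\ll$-contexts $C\in\mathcal J^n$ with $C\vdash\Phi$ (in $\Sigma^{\mathcal J}$), and all $\vec a\in\mathcal M_C$. Adequacy: $\models_m$ is the analogous interpretation with declarations not requiring $C\ll i$ and quantifiers over all $i\in\mathcal I$ ($\forall$: all $i$, all $b$; $\exists$: some $i$, some $b$), with defined families $[\![\Psi]\!]^m$. For an $(n+1)$-ary relation $R_{\mathcal H}$, $C\in\mathcal I^n$, $\vec a\in\mathcal M_C$: $\mathcal I_{R,\vec a:C}=\{i:Ci\in\mathcal H,\exists b\in\mathcal M_i\,R_{Ci}(\vec ab)\}$ if non-empty, else $\mathcal I$;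 $(\ll_R)_{n+1}=\{Ci:i\in\bigcap_{\vec a\in\mathcal M_C}\mathcal I_{R,\vec a:C}\}$, $\ll_R$ generated by it (lower levels: prefixes; higher: products with $\mathcal I$); $(\ll_{\mathcal S})_m=\bigcap_{R\in\mathcal S}(\ll_R)_m$; $\hat{\mathcal T}$: replace $\forall x$ by $\neg\exists x\neg$ and close under subformulas; $\ll_{\mathcal T}=\ll_{\mathcal S_{\mathcal T}}$ with $\mathcal S_{\mathcal T}=\{[\![\Psi]\!]^m:\exists x\Psi\in\hat{\mathcal T}\}$; a model (or $\ll$-relation) is adequate for $\mathcal T$ iff $\ll_n\subseteq(\ll_{\mathcal T})_n$ for all $n$.
   Formalization: Adequacy of M_J is taken with respect to the relation ≪_T of M_I, since with ≪_T recomputed inside M_J it can fail for every finite J; and a declaration in Σ^J is required only for the relation symbols occurring in T, since Σ may be infinite. *)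

(* Defs.v *)
From mathcomp Require Import all_boot.
From mathcomp Require Import boolp classical_sets functions cardinality.

Set Implicit Arguments.
Unset Strict Implicit.
Unset Printing Implicit Defensive.

Local Open Scope classical_set_scope.

Record signature := Signature { sym : Type ; arity : sym -> nat }.

(* [formula Sg n] is the type of n-ary formulas: the free variables are among
   x_0, ..., x_(n-1), and a quantifier in an n-ary formula binds x_n. *)
Inductive formula (Sg : signature) : nat -> Type :=
| Bot n : formula Sg n
| Atom n (R : sym Sg) (k : (arity R).-tuple 'I_n) : formula Sg n
| Imp n : formula Sg n -> formula Sg n -> formula Sg n
| And n : formula Sg n -> formula Sg n -> formula Sg n
| Or n : formula Sg n -> formula Sg n -> formula Sg n
| All n : formula Sg n.+1 -> formula Sg n
| Exi n : formula Sg n.+1 -> formula Sg n.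

Arguments Bot {Sg n}.
Arguments Atom {Sg n} R k.

Definition Neg (Sg : signature) n (Phi : formula Sg n) : formula Sg n :=
  Imp Phi Bot.

Definition any_formula (Sg : signature) : Type := {n : nat & formula Sg n}.

Definition pack (Sg : signature) n (Phi : formula Sg n) : any_formula Sg :=
  existT _ n Phi.

Fixpoint subformulas (Sg : signature) n (Phi : formula Sg n) {struct Phi} :
    set (any_formula Sg) :=
  [set pack Phi] `|`
  match Phi with
  | Bot _ => set0
  | Atom _ _ _ => set0
  | Imp _ Phi1 Phi2 => subformulas Phi1 `|` subformulas Phi2
  | And _ Phi1 Phi2 => subformulas Phi1 `|` subformulas Phi2
  | Or _ Phi1 Phi2 => subformulas Phi1 `|` subformulas Phi2
  | All _ Psi => subformulas Psi
  | Exi _ Psi => subformulas Psi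
  end.

Fixpoint replace_all (Sg : signature) n (Phi : formula Sg n) {struct Phi} :
    formula Sg n :=
  match Phi in formula _ n return formula Sg n with
  | Bot _ => Bot
  | Atom _ R k => Atom R k
  | Imp _ Phi1 Phi2 => Imp (replace_all Phi1) (replace_all Phi2)
  | And _ Phi1 Phi2 => And (replace_all Phi1) (replace_all Phi2)
  | Or _ Phi1 Phi2 => Or (replace_all Phi1) (replace_all Phi2)
  | All _ Psi => Neg (Exi (Neg (replace_all Psi)))
  | Exi _ Psi => Exi (replace_all Psi)
  end.

Definition hat (Sg : signature) (T : set (any_formula Sg)) :
    set (any_formula Sg) :=
  [set p | exists n (Phi : formula Sg n),
     T (pack Phi) /\ subformulas (replace_all Phi) p].

Definition symbols_of (Sg : signature) (T : set (any_formula Sg)) :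
    set (sym Sg) :=
  [set R | exists n (Phi : formula Sg n), T (pack Phi) /\
     exists m (k : (arity R).-tuple 'I_m),
       subformulas Phi (pack (Atom R k))].

(* Contexts are tuples of indices, Ci is [ext C i]; [ext] also extends tuples
   of objects. *)
Definition ext (X : Type) n (C : n.-tuple X) (i : X) : n.+1.-tuple X :=
  [tuple of rcons C i].

Definition power (X : Type) (J : set X) n : set (n.-tuple X) :=
  [set C | forall k, J (tnth C k)].

Arguments power {X} J n.

(* The data of a model. The index set is a subset [idx] of an ambient type U
   and the sets M_i are subsets of an ambient type A, so that a model and its
   restrictions to subsets of the index set have the same type; values at
   indices outside [idx] are irrelevant. The relation interpreting R is the
   family [inst R] on [dom R], and R:C is a declaration iff [decl R C]. *)
Record model (Sg : signature) (U A : Type) := Model {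
  idx : set U ;
  le : U -> U -> Prop ;
  car : U -> set A ;
  decl : forall R : sym Sg, set ((arity R).-tuple U) ;
  dom : forall R : sym Sg, set ((arity R).-tuple U) ;
  inst : forall R : sym Sg, (arity R).-tuple U -> set ((arity R).-tuple A) ;
  ll : forall n, set (n.-tuple U) }.

Arguments decl {Sg U A} m R.
Arguments dom {Sg U A} m R.
Arguments inst {Sg U A} m R C.
Arguments ll {Sg U A} m n.

(* M_C *)
Definition carC (Sg : signature) (U A : Type) (M : model Sg U A)
    n (C : n.-tuple U) : set (n.-tuple A) :=
  [set a | forall k, car M (tnth C k) (tnth a k)].

Definition directed (U : Type) (le : U -> U -> Prop) (J : set U) : Prop :=
  J !=set0 /\
  forall i j, J i -> J j -> exists i', [/\ J i', le i i' & le j i'].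

Definition is_system (Sg : signature) (U A : Type) (M : model Sg U A) : Prop :=
  [/\ (forall i, idx M i -> le M i i),
      (forall i j l, idx M i -> idx M j -> idx M l ->
         le M i j -> le M j l -> le M i l) &
      directed (le M) (idx M)]
  /\
  [/\ (forall i, idx M i -> finite_set (car M i)),
      (forall i j, idx M i -> idx M j -> le M i j -> car M i `<=` car M j) &
      exists2 i, idx M i & car M i !=set0].

(* [inst M R] is a compatible family on [dom M R]: any two members agree on the
   tuples belonging to both of their ranges. *)
Definition is_relation (Sg : signature) (U A : Type) (M : model Sg U A)
    (R : sym Sg) : Prop :=
  [/\ dom M R `<=` power (idx M) (arity R),
      (forall C, dom M R C -> inst M R C `<=` carC M C) &
      forall C D, dom M R C -> dom M R D ->
        inst M R C `&` carC M D = inst M R D `&` carC M C].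

(* [is_model F M]: M is a model when only the symbols in F are considered to
   belong to the signature. *)
Definition is_model (Sg : signature) (U A : Type) (F : set (sym Sg))
    (M : model Sg U A) : Prop :=
  [/\ is_system M,
      (forall R, F R ->
         [/\ is_relation M R, decl M R `<=` dom M R & decl M R !=set0]),
      (forall n, ll M n `<=` power (idx M) n) &
      forall n (C : n.-tuple U) i, ll M n.+1 (ext C i) -> ll M n C].

(* The families D_1 (on sets of indices) and D_n (on sets of contexts). *)
Definition large1 (U : Type) (I : set U) (le : U -> U -> Prop) (H : set U) :
    Prop :=
  exists2 i, I i & [set i' | I i' /\ le i i'] `<=` H.

Fixpoint large (U : Type) (I : set U) (le : U -> U -> Prop) n :
    set (n.-tuple U) -> Prop :=
  match n return set (n.-tuple U) -> Prop with
  | 0 => fun H => H = [set [tuple]]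
  | n'.+1 => fun H =>
      large I le [set C : n'.-tuple U |
        power I n' C /\ large1 I le [set i | I i /\ H (ext C i)]]
  end.

Definition indefinitely_large (Sg : signature) (U A : Type)
    (M : model Sg U A) : Prop :=
  (forall R, large (idx M) (le M) (decl M R)) /\
  (forall n, large (idx M) (le M) (ll M n)).

(* The declaration R:j is available for R x_(k_0) ... x_(k_(m-1)) in C. *)
Definition decl_above (Sg : signature) (U A : Type) (M : model Sg U A)
    n (C : n.-tuple U) (R : sym Sg) (k : (arity R).-tuple 'I_n)
    (j : (arity R).-tuple U) : Prop :=
  decl M R j /\ forall l, le M (tnth C (tnth k l)) (tnth j l).

Definition select (A : Type) n (a : n.-tuple A) m (k : m.-tuple 'I_n) :
    m.-tuple A := [tuple tnth a (tnth k l) | l < m].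

(* C |- Phi *)
Fixpoint declared (Sg : signature) (U A : Type) (M : model Sg U A)
    n (Phi : formula Sg n) {struct Phi} : n.-tuple U -> Prop :=
  match Phi in formula _ n return n.-tuple U -> Prop with
  | Bot n => fun C => ll M n C
  | Atom n R k => fun C => ll M n C /\ exists j, decl_above M C k j
  | Imp _ Phi1 Phi2 => fun C => declared M Phi1 C /\ declared M Phi2 C
  | And _ Phi1 Phi2 => fun C => declared M Phi1 C /\ declared M Phi2 C
  | Or _ Phi1 Phi2 => fun C => declared M Phi1 C /\ declared M Phi2 C
  | All n Psi => fun C =>
      exists i, ll M n.+1 (ext C i) /\ declared M Psi (ext C i)
  | Exi n Psi => fun C =>
      exists i, ll M n.+1 (ext C i) /\ declared M Psi (ext C i)
  end.

(* M |= Phi[a : C] for the relation <<; meaningful for C |- Phi and a in M_C. *)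
Fixpoint sat (Sg : signature) (U A : Type) (M : model Sg U A)
    n (Phi : formula Sg n) {struct Phi} : n.-tuple U -> n.-tuple A -> Prop :=
  match Phi in formula _ n return n.-tuple U -> n.-tuple A -> Prop with
  | Bot _ => fun _ _ => False
  | Atom _ R k => fun C a =>
      exists2 j, decl_above M C k j & inst M R j (select a k)
  | Imp _ Phi1 Phi2 => fun C a => sat M Phi1 C a -> sat M Phi2 C a
  | And _ Phi1 Phi2 => fun C a => sat M Phi1 C a /\ sat M Phi2 C a
  | Or _ Phi1 Phi2 => fun C a => sat M Phi1 C a \/ sat M Phi2 C a
  | All n Psi => fun C a =>
      exists i, [/\ ll M n.+1 (ext C i), declared M Psi (ext C i) &
        forall b, car M i b -> sat M Psi (ext C i) (ext a b)]
  | Exi n Psi => fun C a =>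
      forall i, ll M n.+1 (ext C i) -> declared M Psi (ext C i) ->
        exists2 b, car M i b & sat M Psi (ext C i) (ext a b)
  end.

(* Declarations and interpretation with quantifiers ranging over all indices.
   As Psi[ab : Ci] is only defined if Ci declares Psi, the quantifiers of
   [sat_m] range over the i for which this is the case; if the declarations are
   indefinitely large, these are all indices. *)
Fixpoint declared_m (Sg : signature) (U A : Type) (M : model Sg U A)
    n (Phi : formula Sg n) {struct Phi} : n.-tuple U -> Prop :=
  match Phi in formula _ n return n.-tuple U -> Prop with
  | Bot n => fun C => power (idx M) n C
  | Atom n R k => fun C => power (idx M) n C /\ exists j, decl_above M C k j
  | Imp _ Phi1 Phi2 => fun C => declared_m M Phi1 C /\ declared_m M Phi2 C
  | And _ Phi1 Phi2 => fun C => declared_m M Phi1 C /\ declared_m M Phi2 C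
  | Or _ Phi1 Phi2 => fun C => declared_m M Phi1 C /\ declared_m M Phi2 C
  | All n Psi => fun C => exists i, idx M i /\ declared_m M Psi (ext C i)
  | Exi n Psi => fun C => exists i, idx M i /\ declared_m M Psi (ext C i)
  end.

Fixpoint sat_m (Sg : signature) (U A : Type) (M : model Sg U A)
    n (Phi : formula Sg n) {struct Phi} : n.-tuple U -> n.-tuple A -> Prop :=
  match Phi in formula _ n return n.-tuple U -> n.-tuple A -> Prop with
  | Bot _ => fun _ _ => False
  | Atom _ R k => fun C a =>
      exists2 j, decl_above M C k j & inst M R j (select a k)
  | Imp _ Phi1 Phi2 => fun C a => sat_m M Phi1 C a -> sat_m M Phi2 C a
  | And _ Phi1 Phi2 => fun C a => sat_m M Phi1 C a /\ sat_m M Phi2 C a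
  | Or _ Phi1 Phi2 => fun C a => sat_m M Phi1 C a \/ sat_m M Phi2 C a
  | All n Psi => fun C a =>
      forall i, idx M i -> declared_m M Psi (ext C i) ->
        forall b, car M i b -> sat_m M Psi (ext C i) (ext a b)
  | Exi n Psi => fun C a =>
      exists i, [/\ idx M i, declared_m M Psi (ext C i) &
        exists2 b, car M i b & sat_m M Psi (ext C i) (ext a b)]
  end.

(* The family [[Phi]]^m, with domain [declared_m M Phi]. *)
Definition defined_m (Sg : signature) (U A : Type) (M : model Sg U A)
    n (Phi : formula Sg n) (C : n.-tuple U) : set (n.-tuple A) :=
  [set a | carC M C a /\ sat_m M Phi C a].

(* The set I_(R, a:C) of an (n+1)-ary relation R with domain H. *)
Definition witness_indices (Sg : signature) (U A : Type) (M : model Sg U A)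
    n (H : set (n.+1.-tuple U)) (R : n.+1.-tuple U -> set (n.+1.-tuple A))
    (C : n.-tuple U) (a : n.-tuple A) : set U :=
  let W := [set i | [/\ idx M i, H (ext C i) &
                        exists2 b, car M i b & R (ext C i) (ext a b)]] in
  if `[< W !=set0 >] then W else idx M.

(* Level n+1 of <<_R. *)
Definition ll_rel_top (Sg : signature) (U A : Type) (M : model Sg U A)
    n (H : set (n.+1.-tuple U)) (R : n.+1.-tuple U -> set (n.+1.-tuple A)) :
    set (n.+1.-tuple U) :=
  [set D | exists C i, [/\ D = ext C i, power (idx M) n C, idx M i &
     forall a, carC M C a -> witness_indices M H R C a i]].

(* The relation generated by a set G of contexts of length n. The equation says
   that C is a prefix of D (if m <= n), or that D is a prefix of C (if n <= m). *)
Definition generated (U : Type) (I : set U) n (G : set (n.-tuple U)) m :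
    set (m.-tuple U) :=
  [set C | power I m C /\ exists2 D, G D & take n C = take m D :> seq U].

(* The relation <<_T of the model M; an intersection over no relation at all
   gives all contexts. *)
Definition ll_formulas (Sg : signature) (U A : Type) (M : model Sg U A)
    (T : set (any_formula Sg)) m : set (m.-tuple U) :=
  [set C | power (idx M) m C /\
     forall n (Psi : formula Sg n.+1), hat T (pack (Exi Psi)) ->
       generated (idx M)
         (ll_rel_top M (declared_m M Psi) (defined_m M Psi)) C].

(* Adequacy of a <<-relation L on (some of) the indices of M. The model M is
   adequate if [ll M] is. A model M_J is adequate if its restricted <<-relation
   is, where <<_T and the relations [[Psi]]^m are those of M: with [[Psi]]^m
   evaluated in a finite M_J instead, adequacy is in general not inherited by
   any finite J (the largest elements of M_J become spurious witnesses). *)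
Definition adequate (Sg : signature) (U A : Type) (M : model Sg U A)
    (T : set (any_formula Sg)) (L : forall n, set (n.-tuple U)) : Prop :=
  forall n, L n `<=` @ll_formulas Sg U A M T n.

(* M_J, with the declarations and << restricted to J. *)
Definition restrict_to (Sg : signature) (U A : Type) (M : model Sg U A)
    (J : set U) : model Sg U A :=
  {| idx := J ;
     le := le M ;
     car := car M ;
     decl := fun R => decl M R `&` power J (arity R) ;
     dom := fun R => dom M R `&` power J (arity R) ;
     inst := inst M ;
     ll := fun n => ll M n `&` power J n |}.

Definition submodel (Sg : signature) (U A : Type) (M : model Sg U A)
    (T : set (any_formula Sg)) (J : set U) : Prop :=
  [/\ J `<=` idx M, directed (le M) J &
    forall n (Phi : formula Sg n), T (pack Phi) ->
      forall C : n.-tuple U, ll (restrict_to M J) n C ->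
        declared (restrict_to M J) Phi C ->
        forall a, carC M C a ->
          (sat (restrict_to M J) Phi C a <-> sat M Phi C a)].

(* Main.v *)
Require Import Defs.
From mathcomp Require Import all_boot.
From mathcomp Require Import boolp classical_sets functions cardinality.

Local Open Scope classical_set_scope.

(** Under adequacy, [sat] agrees with the interpretation [sat_m] on declared
    formulas, and this holds for the restriction of the model to any set of
    indices whatsoever: if C << i and some index carries a witness for
    [exists x Psi], then so does i, hence it does not matter over which indices
    C << i the quantifier ranges; universal quantifiers are dual, and atoms do
    not depend on the chosen declaration by compatibility. Hence for J one can
    take the indices of I0, one index with a non-empty set, those of one
    declaration for each symbol of T, and an upper bound of all these. *)

(** * Contexts and tuples of objects extended by one entry *)

Section Tuples.
Set Implicit Arguments.
Unset Strict Implicit.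
Context {X Y : Type} {n : nat}.
Implicit Types (C : n.-tuple X) (a : n.-tuple Y).

Lemma tnth_ext (Q : X -> Y -> Prop) C a i b :
  (forall k, Q (tnth C k) (tnth a k)) -> Q i b ->
  forall k, Q (tnth (ext C i) k) (tnth (ext a b) k).
Proof.
move=> QCa Qib k.
rewrite (tnth_nth i) (tnth_nth b) /= !nth_rcons !size_tuple.
case: (ltngtP k n) => [kn|nk|//].
  by have := QCa (Ordinal kn); rewrite (tnth_nth i) (tnth_nth b).
by have := ltn_ord k; rewrite ltnS leqNgt nk.
Qed.

Lemma ext_inj C D i j : ext C i = ext D j -> C = D /\ i = j.
Proof. by move=> /(congr1 val) /rcons_inj [CD ->]; split=> //; apply: val_inj. Qed.

Lemma power_ext (J : set X) C i : power J n.+1 (ext C i) -> power J n C.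
Proof.
move=> JCi k; have := JCi (widen_ord (leqnSn n) k).
by rewrite !(tnth_nth i) /= nth_rcons size_tuple ltn_ord.
Qed.

Lemma power_last (J : set X) C i : power J n.+1 (ext C i) -> J i.
Proof.
move=> /(_ ord_max).
by rewrite (tnth_nth i) /= nth_rcons size_tuple ltnn eqxx.
Qed.

End Tuples.

Section Interpretations.
Set Implicit Arguments.
Unset Strict Implicit.
Context {Sg : signature} {U A : Type}.
Implicit Types (M : model Sg U A) (J : set U) (T : set (any_formula Sg)).

Lemma carC_ext M n (C : n.-tuple U) (a : n.-tuple A) i b :
  carC M C a -> car M i b -> carC M (ext C i) (ext a b).
Proof. by move=> Ca Mb k; apply: (@tnth_ext _ _ _ (car M)). Qed.

(** * The interpretation [sat_m] and the replacement of universal quantifiers *)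

Lemma declared_m_power M n (Phi : formula Sg n) C :
  declared_m M Phi C -> power (idx M) n C.
Proof.
elim: Phi C => //= {n} [n R k|n P IHP Q _|n P IHP Q _|n P IHP Q _|n P IH|n P IH] C.
- by case.
- by move=> -[dP _]; apply: IHP dP.
- by move=> -[dP _]; apply: IHP dP.
- by move=> -[dP _]; apply: IHP dP.
- by move=> -[i [_ dP]]; apply: power_ext (IH _ dP).
- by move=> -[i [_ dP]]; apply: power_ext (IH _ dP).
Qed.

Lemma declared_m_Neg M n (Phi : formula Sg n) C :
  declared_m M (Neg Phi) C <-> declared_m M Phi C.
Proof. by split=> [[]//|dP]; split=> //; apply: declared_m_power dP. Qed.

Lemma declared_m_replace_all M n (Phi : formula Sg n) C :
  declared_m M (replace_all Phi) C <-> declared_m M Phi C.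
Proof.
elim: Phi C => //= {n} [n P IHP Q IHQ|n P IHP Q IHQ|n P IHP Q IHQ|n P IH|n P IH] C.
- by rewrite IHP IHQ.
- by rewrite IHP IHQ.
- by rewrite IHP IHQ.
- rewrite -/(Neg _) -/(declared_m M (Exi (Neg (replace_all P))) C).
  split=> [[[i [Ii [dP _]]] _]|[i [Ii dP]]].
    by exists i; split=> //; apply/IH.
  (* The outer [Neg] adds [Bot], which is declared at every context of indices. *)
  split; last exact: power_ext (declared_m_power dP).
  by exists i; split=> //; apply/declared_m_Neg/IH.
- by split=> -[i [Ii dP]]; exists i; split=> //; apply/IH.
Qed.

(** Classical duality of the quantifiers of [sat_m]. It applies index by index because the
    replacement does not change where a formula is declared. *)
Lemma sat_m_replace_all M n (Phi : formula Sg n) C a :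
  sat_m M (replace_all Phi) C a <-> sat_m M Phi C a.
Proof.
elim: Phi C a => //= {n} [n P IHP Q IHQ|n P IHP Q IHQ|n P IHP Q IHQ|n P IH|n P IH] C a.
- by rewrite IHP IHQ.
- by rewrite IHP IHQ.
- by rewrite IHP IHQ.
- split=> [nex i Ii dP b Mb|allP [i [Ii [dP _] [b Mb nP]]]].
    apply: contrapT => nP; apply: nex; exists i; split=> //.
      exact/declared_m_Neg/declared_m_replace_all.
    by exists b => // /IH.
  by apply/nP/IH/allP => //; apply/declared_m_replace_all.
- split=> -[i [Ii dP [b Mb Pb]]]; exists i; split=> //;
    by [apply/declared_m_replace_all | exists b => //; apply/IH].
Qed.

(** * Declarations in a restriction *)

Lemma declared_restrict_m M J n (Phi : formula Sg n) C :
  (forall n, ll M n `<=` power (idx M) n) ->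
  declared (restrict_to M J) Phi C -> declared_m M Phi C.
Proof.
move=> llI; elim: Phi C => /= {n}
  [n|n R k|n P IHP Q IHQ|n P IHP Q IHQ|n P IHP Q IHQ|n P IH|n P IH] C.
- by case=> /llI.
- by case=> -[/llI IC _] [j [[dj _] Cj]]; split=> //; exists j.
- by move=> -[dP dQ]; split; [apply: IHP|apply: IHQ].
- by move=> -[dP dQ]; split; [apply: IHP|apply: IHQ].
- by move=> -[dP dQ]; split; [apply: IHP|apply: IHQ].
- by move=> -[i [[/llI ICi _] /IH dP]]; exists i; split=> //; apply: power_last ICi.
- by move=> -[i [[/llI ICi _] /IH dP]]; exists i; split=> //; apply: power_last ICi.
Qed.

(** Serves with [K] the full index set, to pass from declarations in a restriction to declarations
    in the model. *)
Lemma declared_restrict_sub M J K n (Phi : formula Sg n) C :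
  J `<=` K ->
  declared (restrict_to M J) Phi C -> declared (restrict_to M K) Phi C.
Proof.
move=> JK.
have JKn m : power J m `<=` power K m by move=> D JD k; apply: JK.
elim: Phi C => /= {n}
  [n|n R k|n P IHP Q IHQ|n P IHP Q IHQ|n P IHP Q IHQ|n P IH|n P IH] C.
- by case=> lC /JKn KC.
- case=> -[lC /JKn KC] [j [[dj /JKn Kj] Cj]]; split=> //.
  by exists j.
- by move=> -[dP dQ]; split; [apply: IHP|apply: IHQ].
- by move=> -[dP dQ]; split; [apply: IHP|apply: IHQ].
- by move=> -[dP dQ]; split; [apply: IHP|apply: IHQ].
- by case=> i [[lC /JKn KC] /IH dP]; exists i.
- by case=> i [[lC /JKn KC] /IH dP]; exists i.
Qed.

(** Declarations, domains and contexts of a model already consist of its indices. Thus statements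
    about restrictions also cover [M] itself. *)
Lemma restrict_to_idx M : is_model setT M -> restrict_to M (idx M) = M.
Proof.
case: M => I le car decl dom inst ll [_ rel llI _] /=; rewrite /restrict_to /=.
congr Model.
- apply: functional_extensionality_dep => R; apply: setIidl.
  by have [//|[domI _ _] dd _] := rel R => C /dd /domI.
- apply: functional_extensionality_dep => R; apply: setIidl.
  by have [//|[domI _ _] _ _] := rel R.
- by apply: functional_extensionality_dep => n; apply: setIidl; apply: llI.
Qed.

(** * Adequacy and the agreement of the interpretations *)

Lemma adequate_witness M T n (Psi : formula Sg n.+1) C i a :
  adequate M T (ll M) -> hat T (pack (Exi Psi)) ->
  ll M n.+1 (ext C i) -> carC M C a ->
  (exists i', [/\ idx M i', declared_m M Psi (ext C i') &
     exists2 b, car M i' b & sat_m M Psi (ext C i') (ext a b)]) ->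
  exists2 b, car M i b & sat_m M Psi (ext C i) (ext a b).
Proof.
move=> adM hT /adM [_ /(_ n Psi hT) [_ [D [C' [i' [-> _ _ wit]]] eqC]]] Ca ex.
(* At level [n.+1] both contexts have full length, so being generated means being equal. *)
move: eqC; rewrite !take_oversize ?size_tuple// => eqC.
have [CC' ii'] := ext_inj (val_inj eqC).
subst C' i'; have := wit a Ca; rewrite /witness_indices.
(* Adequacy puts [i] among the [witness_indices]; the given witness excludes their default value
   [idx M]. *)
case: asboolP => [_ [_ _ [b Mb [_ Pb]]]|[]]; first by exists b.
have [j [Ij dP [b Mb Pb]]] := ex; exists j; split=> //.
by exists b => //; split=> //; apply: carC_ext.
Qed.

(** Adequacy moves a witness from any index to whichever index the quantifier of [sat] inspects, so
    [J] can be arbitrary. The hypothesis concerns [hat T] because it must pass to subformulas in the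
    induction. *)
Lemma sat_restrict_m M T J n (Phi : formula Sg n) C a :
  is_model setT M -> adequate M T (ll M) ->
  subformulas (replace_all Phi) `<=` hat T ->
  declared (restrict_to M J) Phi C -> carC M C a ->
  (sat (restrict_to M J) Phi C a <-> sat_m M Phi C a).
Proof.
move=> [[[_ _ _] [_ carM _]] rel llI llp] adM.
have idx_ext m (D : m.-tuple U) i : ll M m.+1 (ext D i) -> idx M i.
  by move=> lDi; apply: power_last (llI _ _ lDi).
elim: Phi C a => /= {n}
  [n|n R k|n P IHP Q IHQ|n P IHP Q IHQ|n P IHP Q IHQ|n P IH|n P IH] C a.
- by [].
- move=> _ [[llC _] [j0 [[dj0 Jj0] Cj0]]] Ca.
  have [//|[domI _ compat] dd _] := rel R.
  (* The sets grow along [le], so the selected objects lie in the range of every declaration above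
     [C], as compatibility requires. *)
  have carj j : decl_above M C k j -> carC M j (select a k).
    move=> [/dd /domI Ij Cj] l; rewrite tnth_mktuple.
    exact: (carM _ _ (llI _ _ llC _) (Ij l) (Cj l)).
  split=> [[j [[dj _] Cj] Rj]|[j [dj Cj] Rj]]; first by exists j.
  (* The entries of [j] may lie outside [J]; compatibility allows replacing it by [j0]. *)
  exists j0; first by [].
  have : (inst M R j `&` carC M j0) (select a k) by split=> //; apply: carj.
  by rewrite (compat _ _ (dd _ dj) (dd _ dj0)) => -[].
- move=> sT [dP dQ] Ca.
  have PE := IHP C a (fun p s => sT p (or_intror (or_introl s))) dP Ca.
  have QE := IHQ C a (fun p s => sT p (or_intror (or_intror s))) dQ Ca.
  by rewrite PE QE.
- move=> sT [dP dQ] Ca.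
  have PE := IHP C a (fun p s => sT p (or_intror (or_introl s))) dP Ca.
  have QE := IHQ C a (fun p s => sT p (or_intror (or_intror s))) dQ Ca.
  by rewrite PE QE.
- move=> sT [dP dQ] Ca.
  have PE := IHP C a (fun p s => sT p (or_intror (or_introl s))) dP Ca.
  have QE := IHQ C a (fun p s => sT p (or_intror (or_intror s))) dQ Ca.
  by rewrite PE QE.
- move=> sT [i0 [llCi0 dP0]] Ca.
  have sP : subformulas (replace_all P) `<=` hat T.
    by move=> p s; apply: sT; right; left; right; right; left.
  have hT : hat T (pack (Exi (Neg (replace_all P)))).
    by apply: sT; right; left; left.
  (* If [P] failed at [i'] and [b'], adequacy would give a counterexample at [i], where [sat]
     asserts [P] for all objects. *)
  split=> [[i [[llCi JCi] dP allP]] i' Ii' dP' b' Mb'|allP].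
    apply: contrapT => nP.
    have [|b Mb nPb] := adequate_witness adM hT llCi Ca.
      exists i'; split=> //; first exact/declared_m_Neg/declared_m_replace_all.
      by exists b' => // /sat_m_replace_all.
    apply/nPb/sat_m_replace_all/IH => //; last exact: allP.
    exact: carC_ext.
  exists i0; split=> // b Mb; apply/IH => //; first exact: carC_ext.
  case: llCi0 => llCi0 _; apply: allP => //; first exact: idx_ext llCi0.
  exact: declared_restrict_m dP0.
- move=> sT [i0 [llCi0 dP0]] Ca.
  have sP : subformulas (replace_all P) `<=` hat T.
    by move=> p s; apply: sT; right.
  have hT : hat T (pack (Exi (replace_all P))) by apply: sT; left.
  (* The declaration supplies [i0], so the quantifier over indices in [sat] is not vacuous.
     Conversely, adequacy moves the witness from [i'] to [i]. *)
  split=> [/(_ i0 llCi0 dP0) [b Mb Pb]|[i' [Ii' dP' [b' Mb' Pb']]] i [llCi JCi] dP].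
    case: llCi0 => llCi0 _.
    exists i0; split; [exact: idx_ext llCi0|exact: declared_restrict_m dP0|].
    by exists b => //; apply/(IH _ _ sP dP0 (carC_ext Ca Mb)).
  have [|b Mb Pb] := adequate_witness adM hT llCi Ca.
    exists i'; split=> //; first exact/declared_m_replace_all.
    by exists b' => //; apply/sat_m_replace_all.
  exists b => //; apply/IH => //; first exact: carC_ext.
  exact/sat_m_replace_all.
Qed.

(** Both sides are compared with [sat_m], restricting once to [J] and once to [idx M]. *)
Lemma sat_restrict M T J n (Phi : formula Sg n) C a :
  is_model setT M -> adequate M T (ll M) -> T (pack Phi) -> J `<=` idx M ->
  declared (restrict_to M J) Phi C -> carC M C a ->
  (sat (restrict_to M J) Phi C a <-> sat M Phi C a).
Proof.
move=> modM adM TPhi JI dPhi Ca.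
have hT : subformulas (replace_all Phi) `<=` hat T.
  by move=> p s; exists n, Phi.
have JE := sat_restrict_m modM adM hT dPhi Ca.
have dI := declared_restrict_sub JI dPhi.
have := sat_restrict_m modM adM hT dI Ca.
by rewrite (restrict_to_idx modM) JE => ->.
Qed.

(** * Finiteness, upper bounds and restricted models *)

Lemma finite_subformulas n (Phi : formula Sg n) : finite_set (subformulas Phi).
Proof.
by elim: Phi => //= {n} *; rewrite !finite_setU; do ?split.
Qed.

Definition head_symbol (p : any_formula Sg) : set (sym Sg) :=
  match projT2 p with Atom _ R _ => [set R] | _ => set0 end.

Lemma finite_symbols_of T : finite_set T -> finite_set (symbols_of T).
Proof.
move=> finT; apply: (@sub_finite_set _ _
  (\bigcup_(p in T) \bigcup_(q in subformulas (projT2 p)) head_symbol q)).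
  by move=> R [n [Phi [TPhi [m [k sR]]]]]; exists (pack Phi) => //;
    exists (pack (Atom R k)).
apply: bigcup_finite => // p _; apply: bigcup_finite => [|[m q] _].
  exact: finite_subformulas.
by case: q => *; rewrite /head_symbol /=.
Qed.

Lemma directed_upper_bound (le : U -> U -> Prop) (I F : set U) :
  (forall i j l, I i -> I j -> I l -> le i j -> le j l -> le i l) ->
  directed le I -> finite_set F -> F `<=` I ->
  exists2 u, I u & forall i, F i -> le i u.
Proof.
(* Classically [U] carries a choice structure, so that [F] can be listed as a sequence. *)
elim/Pchoice: U => V in le I F * => tle [[i0 Ii0] ub] /finite_seqP[s ->].
elim: s => [|x s IH] sI; first by exists i0.
have [|u Iu leu] := IH; first by move=> i si; apply: sI; rewrite /= inE si orbT.
have Ix : I x by apply: sI; rewrite /= mem_head.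
have [v [Iv uv xv]] := ub _ _ Iu Ix; exists v => // i.
rewrite /= inE => /orP[/eqP->//|si].
apply: tle (leu i si) uv => //; apply: sI.
by rewrite /= inE si orbT.
Qed.

(** Conditions on all indices pass to subsets; the existential ones have to be supplied for [J]. *)
Lemma restrict_model M (F : set (sym Sg)) J :
  is_model setT M -> J `<=` idx M -> directed (le M) J ->
  (exists2 i, J i & car M i !=set0) ->
  (forall R, F R -> decl M R `&` power J (arity R) !=set0) ->
  is_model F (restrict_to M J).
Proof.
move=> [[[rM tM dirM] [finM carM _]] rel llI llp] JI dirJ neJ declJ.
split=> /=.
- split; split=> //=.
  + by move=> i /JI /rM.
  + by move=> i j l /JI Ii /JI Ij /JI Il; apply: tM.
  + by move=> i /JI /finM.
  + by move=> i j /JI Ii /JI Ij; apply: carM.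
- move=> R FR; have [//|[domI instM compat] dd _] := rel R.
  split; last exact: declJ.
    split=> /= [C [] //|C [/instM//]|C D [dC _] [dD _]]; exact: compat.
  by move=> C [/dd].
- by move=> n C [].
- by move=> n C i [/llp llC JCi]; split=> //; apply: power_ext JCi.
Qed.

End Interpretations.

Theorem theorem4p20 (Sg : signature) (U A : Type) (M : model Sg U A)
    (T : set (any_formula Sg)) (I0 : set U) :
  is_model setT M ->
  indefinitely_large M ->
  finite_set T ->
  finite_set I0 -> I0 `<=` idx M ->
  adequate M T (ll M) ->
  exists J : set U,
    [/\ finite_set J, I0 `<=` J & J `<=` idx M] /\
    [/\ is_model (symbols_of T) (restrict_to M J),
        submodel M T J &
        adequate M T (ll (restrict_to M J))].
Proof.
move=> modM _ finT finI0 I0I adM.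
have [[[rM tM dirM] [_ _ [i1 Ii1 nei1]]] rel _ _] := modM.
have ex_decl R : exists C, decl M R C by have [//|_ _] := rel R.
pose D R := projT1 (cid (ex_decl R)).
have declD R : decl M R (D R) := projT2 (cid (ex_decl R)).
(* [i1] keeps the restricted system from being empty, and the entries of [D R] keep each symbol of
   [T] declared. *)
pose F := I0 `|` ([set i1] `|` \bigcup_(R in symbols_of T) range (tnth (D R))).
have finF : finite_set F.
  rewrite !finite_setU; do ![split] => //.
  apply: bigcup_finite => [|R _]; first exact: finite_symbols_of.
  exact/finite_image/finite_finset.
have FI : F `<=` idx M.
  move=> i [/I0I//|[->//|[R _ [k _ <-]]]].
  by have [//|[domI _ _] dd _] := rel R; apply/domI/dd.
have [u Iu leu] := directed_upper_bound tM dirM finF FI.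
(* Adding the upper bound [u] makes the set directed. *)
pose J := F `|` [set u].
have JI : J `<=` idx M by move=> i [/FI//|->].
have dirJ : directed (le M) J.
  have leJ i : J i -> le M i u by case=> [/leu//|->]; apply: rM.
  split=> [|i j Ji Jj]; first by exists u; right.
  by exists u; split; [right|apply: leJ|apply: leJ].
exists J; split.
  split=> //; first by rewrite finite_setU.
  by move=> i I0i; left; left.
split.
- apply: restrict_model => //.
    by exists i1 => //; left; right; left.
  move=> R TR; exists (D R); split=> // k.
  by left; right; right; exists R => //; exists k.
- split=> // n Phi TPhi C _ dPhi a Ca.
  exact: (sat_restrict modM adM).
(* Restricted contexts are contexts of [M], and [adequate M] tests them against the relation
   computed in [M]. *)
- by move=> n C [/adM].
Qed.
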